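(* Let $\mathcal{G}$ be a groupoid with set of objects $X_{\mathcal{G}}$, source $s_{\mathcal{G}}$, target $t_{\mathcal{G}}$, identity $\iota_{\mathcal{G}}$ and inversion $g\mapsto g^{-1}$, and let $\mathcal{G}^2=\mathcal{G}\times\mathcal{G}$ be the product groupoid. Define $J_{c}:\mathcal{G}\to X_{\mathcal{G}}\times X_{\mathcal{G}}$ by $J_{c}(g):=(s_{\mathcal{G}}(g),t_{\mathcal{G}}(g))$ and, on the set $$\mathcal{G}\times_{J_{c}}\mathcal{G}^2=\{(g_3;g_1,g_2)\in\mathcal{G}^3: t_{\mathcal{G}}(g_1)=s_{\mathcal{G}}(g_3),\ t_{\mathcal{G}}(g_2)=t_{\mathcal{G}}(g_3)\},$$ define $\Psi_{c}(g_3;g_1,g_2):=g_2^{-1}g_3g_1\in\mathcal{G}$. Then $J_{c}$ and $\Psi_{c}$ define a right action of the groupoid $\mathcal{G}^2$ on the set $\mathcal{G}$ (with momentum $J_{c}$ and action map $\Psi_{c}$).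
   Context: A groupoid $\mathcal{G}$ consists of a set of arrows (also denoted $\mathcal{G}$), a set of objects $X_{\mathcal{G}}$, source and target maps $s_{\mathcal{G}},t_{\mathcal{G}}:\mathcal{G}\to X_{\mathcal{G}}$, an identity map $\iota_{\mathcal{G}}:X_{\mathcal{G}}\to\mathcal{G}$, and an inversion, satisfying the usual axioms; the product $g_1g_2$ is defined exactly when $s_{\mathcal{G}}(g_1)=t_{\mathcal{G}}(g_2)$. No smooth structure is assumed. The product groupoid $\mathcal{G}\times\mathcal{H}$ has arrows $\mathcal{G}\times\mathcal{H}$, objects $X_{\mathcal{G}}\times X_{\mathcal{H}}$, and all structure maps and the partial product defined componentwise. A right action of a groupoid $\mathcal{H}$ on a set $N$ consists of a map $J:N\to X_{\mathcal{H}}$ (the momentum) and a map $\Psi:N\times_J\mathcal{H}\to N$, $\Psi(n,h)=nh$, where $N\times_J\mathcal{H}=\{(n,h):J(n)=t_{\mathcal{H}}(h)\}$, such that (i) $J(nh)=s_{\mathcal{H}}(h)$; (ii) $(nh_1)h_2=n(h_1h_2)$ whenever $J(n)=t_{\mathcal{H}}(h_1)$ and $s_{\mathcal{H}}(h_1)=t_{\mathcal{H}}(h_2)$; (iii) $n\,\iota_{\mathcal{H}}(J(n))=n$ for all $n\in N$. *)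

(* Defs.v *)
From mathcomp Require Import ssreflect ssrfun.

Set Implicit Arguments.
Unset Strict Implicit.
Unset Printing Implicit Defensive.

(* The product g h is a map on the pairs with [src g = tgt h], so [gmul] takes
   a proof of composability.  The axioms quantify over all such proofs; with
   [gmul1] and [gmulA] this forces [gmul g h p] not to depend on [p] (see
   [gmul_irr]), i.e. [gmul] really is a map on composable pairs. *)
Record groupoid := Groupoid {
  arrow :> Type;
  object : Type;
  src : arrow -> object;
  tgt : arrow -> object;
  idt : object -> arrow;
  ginv : arrow -> arrow;
  gmul : forall g h : arrow, src g = tgt h -> arrow;
  src_mul : forall g h (p : src g = tgt h), src (gmul p) = src h;
  tgt_mul : forall g h (p : src g = tgt h), tgt (gmul p) = tgt g;
  gmulA : forall g h k (p : src g = tgt h) (q : src h = tgt k)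
      (r : src g = tgt (gmul q)) (r' : src (gmul p) = tgt k),
    gmul r = gmul r';
  src_idt : forall x, src (idt x) = x;
  tgt_idt : forall x, tgt (idt x) = x;
  gmul1 : forall g (p : src g = tgt (idt (src g))), gmul p = g;
  gmul1l : forall g (p : src (idt (tgt g)) = tgt g), gmul p = g;
  src_inv : forall g, src (ginv g) = tgt g;
  tgt_inv : forall g, tgt (ginv g) = src g;
  gmulV : forall g (p : src g = tgt (ginv g)), gmul p = idt (tgt g);
  gmulVl : forall g (p : src (ginv g) = tgt g), gmul p = idt (src g)
}.

Arguments src {G} g : rename.
Arguments tgt {G} g : rename.
Arguments idt {G} x : rename.
Arguments ginv {G} g : rename.
Arguments gmul {G} g h p : rename.

Lemma gmul_irr (G : groupoid) (g h : G) (p q : src g = tgt h) :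
  gmul g h p = gmul g h q.
Proof.
have e : src h = tgt (idt (src h)) by rewrite tgt_idt.
have r' : src (gmul g h p) = tgt (idt (src h)) by rewrite src_mul.
have E (k : G) (Ek : k = h) (r : src g = tgt k) (w : src g = tgt h) :
    (forall r0 : src g = tgt k, gmul g k r0 = gmul _ _ r') ->
  gmul g h w = gmul _ _ r'.
  by move: r w; rewrite Ek => r w; apply.
have A (w : src g = tgt h) : gmul g h w = gmul _ _ r'.
  apply: (E (gmul h _ e)); first exact: gmul1.
    by rewrite tgt_mul.
  by move=> r0; exact: gmulA.
by rewrite (A p) (A q).
Qed.

Section ProductGroupoid.
Variables G H : groupoid.

Let psrc (a : G * H) := (src a.1, src a.2).
Let ptgt (a : G * H) := (tgt a.1, tgt a.2).
Let pidt (x : object G * object H) : G * H := (idt x.1, idt x.2).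
Let pinv (a : G * H) : G * H := (ginv a.1, ginv a.2).
Let pmul (a b : G * H) (p : psrc a = ptgt b) : G * H :=
  (gmul a.1 b.1 (f_equal fst p), gmul a.2 b.2 (f_equal snd p)).

Definition prod_groupoid : groupoid.
Proof.
refine (@Groupoid (G * H)%type (object G * object H)%type
          psrc ptgt pidt pinv pmul _ _ _ _ _ _ _ _ _ _ _).
- by move=> a b p; rewrite /psrc !src_mul.
- by move=> a b p; rewrite /ptgt !tgt_mul.
- by move=> a b c p q r r'; congr pair; exact: gmulA.
- by case=> x y; rewrite /psrc !src_idt.
- by case=> x y; rewrite /ptgt !tgt_idt.
- by case=> g h p; congr pair; exact: gmul1.
- by case=> g h p; congr pair; exact: gmul1l.
- by move=> a; rewrite /psrc /ptgt !src_inv.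
- by move=> a; rewrite /psrc /ptgt !tgt_inv.
- by move=> a p; congr pair; exact: gmulV.
- by move=> a p; congr pair; exact: gmulVl.
Defined.

End ProductGroupoid.

(* As for [gmul], [Psi n h p] is n h on the pairs with [p : J n = tgt h].  In
   [actA] and [act1] the composability proofs always exist, by [act_momentum]
   and the groupoid axioms, so quantifying over them loses nothing. *)
Record is_right_action (H : groupoid) (N : Type) (J : N -> object H)
    (Psi : forall (n : N) (h : H), J n = tgt h -> N) : Prop := IsRightAction {
  act_momentum : forall n h (p : J n = tgt h), J (Psi n h p) = src h;
  actA : forall n h1 h2 (p : J n = tgt h1) (q : src h1 = tgt h2)
      (r : J (Psi n h1 p) = tgt h2) (r' : J n = tgt (gmul h1 h2 q)),
    Psi (Psi n h1 p) h2 r = Psi n (gmul h1 h2 q) r';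
  act1 : forall n (p : J n = tgt (idt (J n))), Psi n (idt (J n)) p = n
}.

Arguments is_right_action H N J Psi : clear implicits.

Section Conjugation.
Variable G : groupoid.

Definition J_c (g : G) : object (prod_groupoid G G) := (src g, tgt g).

Lemma J_c_domain (g3 : G) (h : prod_groupoid G G) :
  J_c g3 = tgt h <-> tgt h.1 = src g3 /\ tgt h.2 = tgt g3.
Proof. by rewrite /J_c /=; split=> [[-> ->]|[-> ->]]. Qed.

Lemma Psi_c_composable_l (g3 g2 : G) :
  tgt g2 = tgt g3 -> src (ginv g2) = tgt g3.
Proof. by rewrite src_inv. Qed.

Lemma Psi_c_composable_r (g3 g1 g2 : G) (p : src (ginv g2) = tgt g3) :
  tgt g1 = src g3 -> src (gmul (ginv g2) g3 p) = tgt g1.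
Proof. by rewrite src_mul. Qed.

(* Psi_c (g3; g1, g2) = g2^-1 g3 g1, with h = (g1, g2). *)
Definition Psi_c (g3 : G) (h : prod_groupoid G G) (p : J_c g3 = tgt h) : G :=
  let dom := proj1 (J_c_domain g3 h) p in
  let q := Psi_c_composable_l (proj2 dom) in
  gmul (gmul (ginv h.2) g3 q) h.1 (Psi_c_composable_r q (proj1 dom)).

End Conjugation.

Arguments J_c G g : clear implicits.
Arguments Psi_c G g3 h p : clear implicits.

(* Main.v *)
From mathcomp Require Import ssreflect ssrfun.
Require Import Defs.

(** The formula [g2^-1 g3 g1] combines right translation by [g1] with left
    translation by [g2^-1].  These commute by associativity
    ([gmul_translate]); right translation is compatible with products, and so is
    left translation by inverses because inversion reverses products
    ([ginv_mul]).  Identities act trivially because an identity is its own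
    inverse ([ginv_idt]).  Both facts on inverses come from the uniqueness of
    right inverses ([ginv_unique]). *)

Set Implicit Arguments.
Unset Strict Implicit.
Unset Printing Implicit Defensive.

Section GroupoidLaws.
Variable G : groupoid.
Implicit Types g h k : G.

(** A factor cannot be rewritten inside [gmul], since the composability proof
    depends on it; this congruence replaces such rewriting. *)
Lemma gmul_congr g g' h h' (p : src g = tgt h) (p' : src g' = tgt h') :
  g = g' -> h = h' -> gmul g h p = gmul g' h' p'.
Proof. by move=> eg eh; subst g' h'; exact: gmul_irr. Qed.

Lemma gmul_idr g h (p : src g = tgt h) : h = idt (src g) -> gmul g h p = g.
Proof. by move=> eh; subst h; exact: gmul1. Qed.

Lemma gmul_idl g h (p : src g = tgt h) : g = idt (tgt h) -> gmul g h p = h.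
Proof. by move=> eg; subst g; exact: gmul1l. Qed.

(** If [g h] is an identity, evaluate [g^-1 g h] in both ways. *)
Lemma ginv_unique g h (p : src g = tgt h) :
  gmul g h p = idt (tgt g) -> h = ginv g.
Proof.
move=> gh1.
have q : src (ginv g) = tgt g by rewrite src_inv.
have r : src (ginv g) = tgt (gmul g h p) by rewrite tgt_mul.
have r' : src (gmul (ginv g) g q) = tgt h by rewrite src_mul.
have <- : gmul _ _ r' = h by apply: gmul_idl; rewrite gmulVl p.
by rewrite -(gmulA r r'); apply: gmul_idr; rewrite gh1 src_inv.
Qed.

Lemma ginv_idt (x : object G) : ginv (idt x) = idt x.
Proof.
have p : src (idt x : G) = tgt (idt x : G) by rewrite src_idt tgt_idt.
by apply/esym/(@ginv_unique _ _ p); rewrite gmul_idr ?src_idt ?tgt_idt.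
Qed.

(** The product [g h h^-1 g^-1] collapses from the inside. *)
Lemma ginv_mul g h (p : src g = tgt h) (q : src (ginv h) = tgt (ginv g)) :
  ginv (gmul g h p) = gmul (ginv h) (ginv g) q.
Proof.
have pv : src h = tgt (ginv h) by rewrite tgt_inv.
have r : src g = tgt (gmul h (ginv h) pv) by rewrite tgt_mul.
have r' : src (gmul g h p) = tgt (ginv h) by rewrite src_mul.
have cancel_h : gmul (gmul g h p) (ginv h) r' = g.
  by rewrite -(gmulA r r'); apply: gmul_idr; rewrite gmulV p.
have s : src (gmul g h p) = tgt (gmul (ginv h) (ginv g) q).
  by rewrite src_mul tgt_mul tgt_inv.
have s' : src (gmul (gmul g h p) (ginv h) r') = tgt (ginv g).
  by rewrite src_mul.
have v : src g = tgt (ginv g) by rewrite tgt_inv.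
apply/esym/(@ginv_unique _ _ s).
rewrite (gmulA s s') tgt_mul -(gmulV v).
exact: gmul_congr.
Qed.

(** The law behind the commutation of left and right translations: both sides
    are the product [h u k l]. *)
Lemma gmul_translate h u k l (p : src u = tgt k) (q : src h = tgt (gmul u k p))
    (r : src (gmul h (gmul u k p) q) = tgt l)
    (p' : src h = tgt u) (q' : src k = tgt l)
    (r' : src (gmul h u p') = tgt (gmul k l q')) :
  gmul (gmul h (gmul u k p) q) l r = gmul (gmul h u p') (gmul k l q') r'.
Proof.
have a : src (gmul h u p') = tgt k by rewrite src_mul.
have b : src (gmul (gmul h u p') k a) = tgt l by rewrite src_mul.
rewrite (gmulA r' b); apply: gmul_congr => //.
exact: gmulA.
Qed.

End GroupoidLaws.

Theorem proposition5p5 (G : groupoid) :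
  is_right_action (prod_groupoid G G) G (J_c G) (Psi_c G).
Proof.
split.
- by move=> g h p; rewrite /J_c /Psi_c !(src_mul, tgt_mul) tgt_inv.
- move=> g [a1 a2] [b1 b2] p q r r'.
  have [/= a1g a2g] := proj1 (J_c_domain g (a1, a2)) p.
  have [/= a1b1 a2b2] : src a1 = tgt b1 /\ src a2 = tgt b2 by case: (q).
  have a2Vg : src (ginv a2) = tgt g by rewrite src_inv.
  have b2Va2V : src (ginv b2) = tgt (ginv a2) by rewrite src_inv tgt_inv.
  have m : src (ginv b2) = tgt (gmul (ginv a2) g a2Vg) by rewrite tgt_mul.
  have m' : src (gmul (ginv b2) (ginv a2) b2Va2V) = tgt g by rewrite src_mul.
  have n : src (gmul (ginv b2) (gmul (ginv a2) g a2Vg) m)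
           = tgt (gmul a1 b1 a1b1) by rewrite !src_mul tgt_mul.
  have u : src (gmul (ginv a2) g a2Vg) = tgt a1 by rewrite src_mul.
  have v : src (ginv b2) = tgt (gmul _ _ u) by rewrite !tgt_mul.
  have w : src (gmul _ _ v) = tgt b1 by rewrite !src_mul.
  (* [Psi_c] carries composability proofs extracted from [p] and [r]; replace
     them by the local ones before applying the groupoid laws. *)
  transitivity (gmul _ _ w).
    by do 3![apply: gmul_congr => //]; exact: gmul_congr.
  rewrite (gmul_translate w n); apply: gmul_congr; last exact: gmul_irr.
  rewrite (gmulA m m'); apply: gmul_congr => //.
  by rewrite -(ginv_mul a2b2); congr ginv; exact: gmul_irr.
- move=> g p; rewrite /Psi_c gmul_idr ?src_mul //.
  by apply: gmul_idl; rewrite /= ginv_idt.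
Qed.
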